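(* Let $B$ be a bialgebra in the braided monoidal category $\mathcal{B}$ and let $A$ be an algebra object in the category of left $B$-comodules in $\mathcal{B}$. Let $(V,a_V,\delta_V)$ be a left Yetter--Drinfeld module over $B$ in $\mathcal{B}$, and let $(W,a_W,\delta_W)$ be an object of $A\text{-}\mathbf{Mod}(B\text{-}\mathbf{CoMod})$. Then the tensor product $V\otimes W$ becomes an object $V\triangleright W$ of $A\text{-}\mathbf{Mod}(B\text{-}\mathbf{CoMod})$ with $A$-action $a_{V\triangleright W}$ and left $B$-coaction $\delta_{V\triangleright W}$ given by $$a_{V\triangleright W}:=(a_V\otimes a_W)(\mathrm{Id}_B\otimes \Psi_{A,V}\otimes \mathrm{Id}_W)(\delta_A\otimes \mathrm{Id}_{V\otimes W}),$$ $$\delta_{V\triangleright W}:=(m_B\otimes \mathrm{Id}_{V\otimes W})(\mathrm{Id}_B\otimes \Psi_{V,B}\otimes \mathrm{Id}_W)(\delta_V\otimes \delta_W).$$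
   Context: $\Bbbk$ is a field and $\mathcal{B}$ is a $\Bbbk$-linear braided monoidal category with unit object $I$ and braiding $\Psi$ (associativity and unit isomorphisms are suppressed). A bialgebra $B$ in $\mathcal{B}$ is an object with an associative unital algebra structure $(m_B,1_B)$ and a coassociative counital coalgebra structure $(\Delta,\varepsilon)$, all maps in $\mathcal{B}$, such that $\Delta m_B=(m_B\otimes m_B)(\mathrm{Id}_B\otimes\Psi_{B,B}\otimes \mathrm{Id}_B)(\Delta\otimes\Delta)$, $\Delta 1_B=1_B\otimes 1_B$, $\varepsilon m_B=\varepsilon\otimes\varepsilon$ and $\varepsilon 1_B=\mathrm{Id}_I$. All modules and comodules are objects in $\mathcal{B}$ with structure maps in $\mathcal{B}$. An algebra object in left $B$-comodules is an algebra $(A,m_A,1_A)$ in $\mathcal{B}$ with a left $B$-coaction $\delta_A\colon A\to B\otimes A$ such that $\delta_A m_A=(m_B\otimes m_A)(\mathrm{Id}_B\otimes \Psi_{A,B}\otimes \mathrm{Id}_A)(\delta_A\otimes\delta_A)$ and $\delta_A 1_A=1_B\otimes 1_A$. $A\text{-}\mathbf{Mod}(B\text{-}\mathbf{CoMod})$ is the category of objects $W$ of $\mathcal{B}$ with a left $A$-action $a_W\colon A\otimes W\to W$ and a left $B$-coaction $\delta_W\colon W\to B\otimes W$ such that $a_W$ is a morphism of $B$-comodules, i.e. $\delta_W a_W=(m_B\otimes a_W)(\mathrm{Id}_B\otimes\Psi_{A,B}\otimes\mathrm{Id}_W)(\delta_A\otimes\delta_W)$. A left Yetter--Drinfeld module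 over $B$ in $\mathcal{B}$ is an object $V$ with a left $B$-action $a\colon B\otimes V\to V$ and a left $B$-coaction $\delta\colon V\to B\otimes V$ such that $$(m_B\otimes a)(\mathrm{Id}_B\otimes \Psi_{B,B}\otimes \mathrm{Id}_V)(\Delta\otimes \delta)=(m_B\otimes \mathrm{Id}_V)(\mathrm{Id}_B\otimes \Psi_{V,B})(\delta a\otimes \mathrm{Id}_B)(\mathrm{Id}_B\otimes \Psi_{B,V})(\Delta\otimes \mathrm{Id}_V).$$ *)

(* Defs.v *)
From HB Require Import structures.
From mathcomp Require Import all_boot all_algebra.

Set Implicit Arguments.
Unset Strict Implicit.
Unset Printing Implicit Defensive.

Import GRing.Theory.
Local Open Scope ring_scope.

Declare Scope bcat_scope.
Delimit Scope bcat_scope with bcat.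
Local Open Scope bcat_scope.

Reserved Notation "X ~> Y" (at level 90, right associativity).
Reserved Notation "g ∘ f" (at level 40, left associativity).
Reserved Notation "X ⊗ Y" (at level 38, left associativity).
Reserved Notation "f ⊗₁ g" (at level 38, left associativity).

Record linear_category (k : fieldType) := LinearCategory {
  ob :> Type;
  hom : ob -> ob -> lmodType k;
  idm : forall X, hom X X;
  comp : forall X Y Z, hom Y Z -> hom X Y -> hom X Z;
  comp_idl : forall X Y (f : hom X Y), comp (idm Y) f = f;
  comp_idr : forall X Y (f : hom X Y), comp f (idm X) = f;
  compA : forall X Y Z T (h : hom Z T) (g : hom Y Z) (f : hom X Y),
    comp h (comp g f) = comp (comp h g) f;
  comp_linearl : forall X Y Z (f : hom X Y),
    linear (fun g : hom Y Z => comp g f);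
  comp_linearr : forall X Y Z (g : hom Y Z),
    linear (fun f : hom X Y => comp g f)
}.

Arguments idm {k l} X.
Arguments comp {k l X Y Z} _ _.
Notation "X ~> Y" := (hom X Y) : type_scope.
Notation "g ∘ f" := (comp g f) : bcat_scope.

(* The monoidal structure is not assumed strict: [assoc], [lunit] and [runit]
   are the associativity and unit isomorphisms. *)
Record monoidal_category (k : fieldType) := MonoidalCategory {
  mon_cat :> linear_category k;
  unit_ob : mon_cat;
  tens : mon_cat -> mon_cat -> mon_cat;
  tensm : forall X X' Y Y' : mon_cat,
    (X ~> X') -> (Y ~> Y') -> (tens X Y ~> tens X' Y');
  assoc : forall X Y Z : mon_cat, tens (tens X Y) Z ~> tens X (tens Y Z);
  assoc_inv : forall X Y Z : mon_cat, tens X (tens Y Z) ~> tens (tens X Y) Z;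
  lunit : forall X : mon_cat, tens unit_ob X ~> X;
  lunit_inv : forall X : mon_cat, X ~> tens unit_ob X;
  runit : forall X : mon_cat, tens X unit_ob ~> X;
  runit_inv : forall X : mon_cat, X ~> tens X unit_ob;
  tensm_id : forall X Y : mon_cat, tensm (idm X) (idm Y) = idm (tens X Y);
  tensm_comp : forall (X X' X'' Y Y' Y'' : mon_cat)
      (f' : X' ~> X'') (f : X ~> X') (g' : Y' ~> Y'') (g : Y ~> Y'),
    tensm (f' ∘ f) (g' ∘ g) = tensm f' g' ∘ tensm f g;
  tensm_linearl : forall (X X' Y Y' : mon_cat) (g : Y ~> Y'),
    linear (fun f : X ~> X' => tensm f g);
  tensm_linearr : forall (X X' Y Y' : mon_cat) (f : X ~> X'),
    linear (fun g : Y ~> Y' => tensm f g);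
  assocK : forall X Y Z, assoc_inv X Y Z ∘ assoc X Y Z = idm _;
  assoc_invK : forall X Y Z, assoc X Y Z ∘ assoc_inv X Y Z = idm _;
  lunitK : forall X, lunit_inv X ∘ lunit X = idm _;
  lunit_invK : forall X, lunit X ∘ lunit_inv X = idm _;
  runitK : forall X, runit_inv X ∘ runit X = idm _;
  runit_invK : forall X, runit X ∘ runit_inv X = idm _;
  assoc_nat : forall (X X' Y Y' Z Z' : mon_cat)
      (f : X ~> X') (g : Y ~> Y') (h : Z ~> Z'),
    assoc X' Y' Z' ∘ tensm (tensm f g) h = tensm f (tensm g h) ∘ assoc X Y Z;
  lunit_nat : forall (X X' : mon_cat) (f : X ~> X'),
    lunit X' ∘ tensm (idm unit_ob) f = f ∘ lunit X;
  runit_nat : forall (X X' : mon_cat) (f : X ~> X'),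
    runit X' ∘ tensm f (idm unit_ob) = f ∘ runit X;
  pentagon : forall X Y Z T : mon_cat,
    assoc X Y (tens Z T) ∘ assoc (tens X Y) Z T
    = tensm (idm X) (assoc Y Z T) ∘ assoc X (tens Y Z) T
      ∘ tensm (assoc X Y Z) (idm T);
  triangle : forall X Y : mon_cat,
    tensm (idm X) (lunit Y) ∘ assoc X unit_ob Y = tensm (runit X) (idm Y)
}.

Arguments unit_ob {k m}.
Arguments tens {k m} X Y.
Arguments tensm {k m X X' Y Y'} f g.
Arguments assoc {k m} X Y Z.
Arguments assoc_inv {k m} X Y Z.
Arguments lunit {k m} X.
Arguments lunit_inv {k m} X.
Arguments runit {k m} X.
Arguments runit_inv {k m} X.
Notation "X ⊗ Y" := (tens X Y) : bcat_scope.
Notation "f ⊗₁ g" := (tensm f g) : bcat_scope.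
Notation "'𝟙'" := unit_ob : bcat_scope.
Bind Scope bcat_scope with ob.

Record braided_category (k : fieldType) := BraidedCategory {
  braided_mon :> monoidal_category k;
  braid : forall X Y : braided_mon, X ⊗ Y ~> Y ⊗ X;
  braid_inv : forall X Y : braided_mon, Y ⊗ X ~> X ⊗ Y;
  braidK : forall X Y, braid_inv X Y ∘ braid X Y = idm _;
  braid_invK : forall X Y, braid X Y ∘ braid_inv X Y = idm _;
  braid_nat : forall (X X' Y Y' : braided_mon) (f : X ~> X') (g : Y ~> Y'),
    braid X' Y' ∘ (f ⊗₁ g) = (g ⊗₁ f) ∘ braid X Y;
  hexagon1 : forall X Y Z : braided_mon,
    assoc Y Z X ∘ braid X (Y ⊗ Z) ∘ assoc X Y Z
    = (idm Y ⊗₁ braid X Z) ∘ assoc Y X Z ∘ (braid X Y ⊗₁ idm Z);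
  hexagon2 : forall X Y Z : braided_mon,
    assoc_inv Z X Y ∘ braid (X ⊗ Y) Z ∘ assoc_inv X Y Z
    = (braid X Z ⊗₁ idm Y) ∘ assoc_inv X Z Y ∘ (idm X ⊗₁ braid Y Z)
}.

Arguments braid {k b} X Y.
Arguments braid_inv {k b} X Y.

Section Structures.
Context (k : fieldType) (C : braided_category k).
Implicit Types X Y Z T V W : C.

(* Id_X ⊗ Ψ_{Y,Z} ⊗ Id_T *)
Definition mid_braid X Y Z T : (X ⊗ Y) ⊗ (Z ⊗ T) ~> (X ⊗ Z) ⊗ (Y ⊗ T) :=
  assoc_inv X Z (Y ⊗ T)
  ∘ (idm X ⊗₁ (assoc Z Y T ∘ (braid Y Z ⊗₁ idm T) ∘ assoc_inv Y Z T))
  ∘ assoc X Y (Z ⊗ T).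

Record is_algebra (A : C) (m : A ⊗ A ~> A) (u : 𝟙 ~> A) : Prop := IsAlgebra {
  alg_assoc : m ∘ (m ⊗₁ idm A) = m ∘ (idm A ⊗₁ m) ∘ assoc A A A;
  alg_unitl : m ∘ (u ⊗₁ idm A) = lunit A;
  alg_unitr : m ∘ (idm A ⊗₁ u) = runit A
}.

Record is_coalgebra (B : C) (D : B ~> B ⊗ B) (e : B ~> 𝟙) : Prop :=
  IsCoalgebra {
  coalg_coassoc : assoc B B B ∘ (D ⊗₁ idm B) ∘ D = (idm B ⊗₁ D) ∘ D;
  coalg_counitl : lunit B ∘ (e ⊗₁ idm B) ∘ D = idm B;
  coalg_counitr : runit B ∘ (idm B ⊗₁ e) ∘ D = idm B
}.

Record bialgebra := Bialgebra {
  bi_ob :> C;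
  bi_mul : bi_ob ⊗ bi_ob ~> bi_ob;
  bi_one : 𝟙 ~> bi_ob;
  bi_comul : bi_ob ~> bi_ob ⊗ bi_ob;
  bi_counit : bi_ob ~> 𝟙;
  bi_is_algebra : is_algebra bi_mul bi_one;
  bi_is_coalgebra : is_coalgebra bi_comul bi_counit;
  bi_comul_mul :
    bi_comul ∘ bi_mul
    = (bi_mul ⊗₁ bi_mul) ∘ mid_braid bi_ob bi_ob bi_ob bi_ob
      ∘ (bi_comul ⊗₁ bi_comul);
  bi_comul_one : bi_comul ∘ bi_one = (bi_one ⊗₁ bi_one) ∘ lunit_inv 𝟙;
  bi_counit_mul : bi_counit ∘ bi_mul = lunit 𝟙 ∘ (bi_counit ⊗₁ bi_counit);
  bi_counit_one : bi_counit ∘ bi_one = idm 𝟙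
}.

Record is_left_module (A : C) (m : A ⊗ A ~> A) (u : 𝟙 ~> A)
    (V : C) (a : A ⊗ V ~> V) : Prop := IsLeftModule {
  mod_assoc : a ∘ (m ⊗₁ idm V) = a ∘ (idm A ⊗₁ a) ∘ assoc A A V;
  mod_unit : a ∘ (u ⊗₁ idm V) = lunit V
}.

Record is_left_comodule (B : C) (D : B ~> B ⊗ B) (e : B ~> 𝟙)
    (V : C) (d : V ~> B ⊗ V) : Prop := IsLeftComodule {
  comod_coassoc : assoc B B V ∘ (D ⊗₁ idm V) ∘ d = (idm B ⊗₁ d) ∘ d;
  comod_counit : lunit V ∘ (e ⊗₁ idm V) ∘ d = idm V
}.

Record comodule_algebra (B : bialgebra) := ComoduleAlgebra {
  ca_ob :> C;
  ca_mul : ca_ob ⊗ ca_ob ~> ca_ob;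
  ca_one : 𝟙 ~> ca_ob;
  ca_coact : ca_ob ~> B ⊗ ca_ob;
  ca_is_algebra : is_algebra ca_mul ca_one;
  ca_is_comodule : is_left_comodule (bi_comul B) (bi_counit B) ca_coact;
  ca_coact_mul :
    ca_coact ∘ ca_mul
    = (bi_mul B ⊗₁ ca_mul) ∘ mid_braid B ca_ob B ca_ob
      ∘ (ca_coact ⊗₁ ca_coact);
  ca_coact_one : ca_coact ∘ ca_one = (bi_one B ⊗₁ ca_one) ∘ lunit_inv 𝟙
}.

Record is_mod_comod (B : bialgebra) (A : comodule_algebra B) (W : C)
    (a : A ⊗ W ~> W) (d : W ~> B ⊗ W) : Prop := IsModComod {
  mc_is_module : is_left_module (ca_mul A) (ca_one A) a;
  mc_is_comodule : is_left_comodule (bi_comul B) (bi_counit B) d;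
  mc_compat :
    d ∘ a = (bi_mul B ⊗₁ a) ∘ mid_braid B A B W ∘ (ca_coact A ⊗₁ d)
}.

(* objects of A-Mod(B-CoMod) *)
Record mod_comod (B : bialgebra) (A : comodule_algebra B) := ModComod {
  mc_ob :> C;
  mc_act : A ⊗ mc_ob ~> mc_ob;
  mc_coact : mc_ob ~> B ⊗ mc_ob;
  mc_axioms : is_mod_comod mc_act mc_coact
}.

Record yd_module (B : bialgebra) := YDModule {
  yd_ob :> C;
  yd_act : B ⊗ yd_ob ~> yd_ob;
  yd_coact : yd_ob ~> B ⊗ yd_ob;
  yd_is_module : is_left_module (bi_mul B) (bi_one B) yd_act;
  yd_is_comodule : is_left_comodule (bi_comul B) (bi_counit B) yd_coact;
  yd_compat :
    (bi_mul B ⊗₁ yd_act) ∘ mid_braid B B B yd_ob ∘ (bi_comul B ⊗₁ yd_coact)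
    = (bi_mul B ⊗₁ idm yd_ob)
      ∘ assoc_inv B B yd_ob ∘ (idm B ⊗₁ braid yd_ob B) ∘ assoc B yd_ob B
      ∘ ((yd_coact ∘ yd_act) ⊗₁ idm B)
      ∘ assoc_inv B yd_ob B ∘ (idm B ⊗₁ braid B yd_ob) ∘ assoc B B yd_ob
      ∘ (bi_comul B ⊗₁ idm yd_ob)
}.

Definition tri_act (B : bialgebra) (A : comodule_algebra B)
    (V : yd_module B) (W : mod_comod A) : A ⊗ (V ⊗ W) ~> V ⊗ W :=
  (yd_act V ⊗₁ mc_act W) ∘ mid_braid B A V W ∘ (ca_coact A ⊗₁ idm (V ⊗ W)).

Definition tri_coact (B : bialgebra) (A : comodule_algebra B)
    (V : yd_module B) (W : mod_comod A) : V ⊗ W ~> B ⊗ (V ⊗ W) :=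
  (bi_mul B ⊗₁ idm (V ⊗ W)) ∘ mid_braid B V B W ∘ (yd_coact V ⊗₁ mc_coact W).

End Structures.

(* Main.v *)
Require Import Defs.
From mathcomp Require Import all_boot all_algebra.
Import Defs.

(** The proof is a string-diagram computation, and the work lies in making
string diagrams meaningful when the associativity isomorphisms are not
identities.

An object [X] is replaced by the functor [X ⊗ -], and a list of objects
[X1, ..., Xn] by [X1 ⊗ (... (Xn ⊗ -))]. Composition of functors is strictly
associative, so juxtaposition of wires needs no coherence isomorphism. A
structure map acts on the leftmost wires in front of an arbitrary tail [Z]: a
map [X ⊗ Y ~> X'] becomes [merge f Z : X ⊗ (Y ⊗ Z) ~> X' ⊗ Z], a map
[X ~> Y ⊗ Y'] becomes [split f Z], a unit becomes [create u Z], a counit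
[delete e Z], the braiding [swap X Y Z]. To act deeper in the list one tensors
with identities on the left ([X ◁ f]). Interchange of distant operations
becomes naturality in the tail ([merge_nat], [split_nat], [swap_nat]).
Pentagon, triangle and hexagons are used once and for all, to show that
crossings slide past the other operations ([swap_mergel], [swap_splitl],
[swap_create] and their variants) and that each axiom of the structures at hand
takes its strict form in front of a tail ([merge_act], [split_coact],
[split_merge], [yd_tail], ...).

In this calculus the action on [V ⊗ W] is: coact on [A], let the [A]-strand cross
[V], act on both factors. It is associative because [δ_A] is multiplicative, and
unital because [δ_A] preserves the unit. Dually the coaction is coassociative
and counital because [Δ] and [ε] are multiplicative. For the compatibility
([tri_compat]), substituting the compatibility of [W] in [δ a] produces [δ_A]
twice; coassociativity of [A] turns this into [Δ] after [δ_A], whereupon the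
strands at [V] form the right-hand side of the Yetter-Drinfeld condition.
Replacing it by the left-hand side, both sides become equal up to sliding
strands, one instance of the braid relation ([swap_braid]) and the
associativity of [m_B]. *)

Set Implicit Arguments.
Unset Strict Implicit.
Unset Printing Implicit Defensive.

Local Open Scope bcat_scope.

Local Notation "X ◁ f" := (idm X ⊗₁ f) (at level 36, right associativity).
Local Notation "f ▷ Z" := (f ⊗₁ idm Z) (at level 37, left associativity).

(** * Tensoring with identities, and coherence *)

Section Whiskering.
Context (k : fieldType) (C : braided_category k).
Implicit Types P Q S T U V W X Y Z : C.

Lemma whiskerD X Y Z T (g : Z ~> T) (f : Y ~> Z) : X ◁ (g ∘ f) = X ◁ g ∘ X ◁ f.
Proof. by rewrite -tensm_comp comp_idl. Qed.

Lemma tailD X Y Z T (g : Z ~> T) (f : Y ~> Z) : (g ∘ f) ▷ X = g ▷ X ∘ f ▷ X.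
Proof. by rewrite -tensm_comp comp_idl. Qed.

Lemma exchange X X' Y Y' (f : X ~> X') (g : Y ~> Y') :
  f ▷ Y' ∘ X ◁ g = X' ◁ g ∘ f ▷ Y.
Proof. by rewrite -!tensm_comp !comp_idl !comp_idr. Qed.

Lemma tensmE X X' Y Y' (f : X ~> X') (g : Y ~> Y') : f ⊗₁ g = f ▷ Y' ∘ X ◁ g.
Proof. by rewrite -tensm_comp comp_idl comp_idr. Qed.

(** In a right-nested composite [f1 ∘ (f2 ∘ (... ∘ t))], an equation between
composites of a few factors does not occur as a subterm; the lemmas [at_head]
and [whisker] adapt it to an arbitrary continuation [t] and to a deeper
position. *)
Lemma at_head2 X Y Z T (f : Y ~> Z) (f' : X ~> Y) (g : X ~> Z) (t : T ~> X) :
  f ∘ f' = g -> f ∘ (f' ∘ t) = g ∘ t.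
Proof. by rewrite compA => ->. Qed.

Lemma at_head3 X X' Y Z T (f1 : Y ~> Z) (f2 : X' ~> Y) (f3 : X ~> X')
    (g : X ~> Z) (t : T ~> X) :
  f1 ∘ (f2 ∘ f3) = g -> f1 ∘ (f2 ∘ (f3 ∘ t)) = g ∘ t.
Proof. by rewrite !compA => ->. Qed.

Lemma at_head6 X X1 X2 X3 X4 X5 Z T (f1 : X5 ~> Z) (f2 : X4 ~> X5)
    (f3 : X3 ~> X4) (f4 : X2 ~> X3) (f5 : X1 ~> X2) (f6 : X ~> X1)
    (g : X ~> Z) (t : T ~> X) :
  f1 ∘ (f2 ∘ (f3 ∘ (f4 ∘ (f5 ∘ f6)))) = g ->
  f1 ∘ (f2 ∘ (f3 ∘ (f4 ∘ (f5 ∘ (f6 ∘ t))))) = g ∘ t.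
Proof. by rewrite !compA => ->. Qed.

Lemma whisker2 X Y Z T (f : Y ~> Z) (f' : X ~> Y) (g : X ~> Z) :
  f ∘ f' = g -> T ◁ f ∘ T ◁ f' = T ◁ g.
Proof. by rewrite -whiskerD => ->. Qed.

Lemma whisker3 X X' Y Z T (f1 : Y ~> Z) (f2 : X' ~> Y) (f3 : X ~> X')
    (g : X ~> Z) :
  f1 ∘ (f2 ∘ f3) = g -> T ◁ f1 ∘ (T ◁ f2 ∘ T ◁ f3) = T ◁ g.
Proof. by rewrite -!whiskerD => ->. Qed.

Lemma cancel_epi X Y Z (h : X ~> Y) (h' : Y ~> X) (f g : Y ~> Z) :
  h ∘ h' = idm Y -> f ∘ h = g ∘ h -> f = g.
Proof. by move=> hK e; rewrite -[f]comp_idr -[g]comp_idr -hK !compA e. Qed.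

Lemma cancel_mono X Y Z (h : Y ~> Z) (h' : Z ~> Y) (f g : X ~> Y) :
  h' ∘ h = idm Y -> h ∘ f = h ∘ g -> f = g.
Proof. by move=> hK e; rewrite -[f]comp_idl -[g]comp_idl -hK -!compA e. Qed.

Lemma whisker_inv X Y Z (h : X ~> Y) (h' : Y ~> X) :
  h ∘ h' = idm Y -> Z ◁ h ∘ Z ◁ h' = idm (Z ⊗ Y).
Proof. by move=> e; rewrite -whiskerD e tensm_id. Qed.

Lemma tail_inv X Y Z (h : X ~> Y) (h' : Y ~> X) :
  h ∘ h' = idm Y -> h ▷ Z ∘ h' ▷ Z = idm (Y ⊗ Z).
Proof. by move=> e; rewrite -tailD e tensm_id. Qed.

Lemma assoc_epi X Y Z T (f g : X ⊗ (Y ⊗ Z) ~> T) :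
  f ∘ assoc X Y Z = g ∘ assoc X Y Z -> f = g.
Proof. exact: cancel_epi (assoc_invK X Y Z). Qed.

Lemma assoc_tail_epi X Y Z U T (f g : (X ⊗ (Y ⊗ Z)) ⊗ U ~> T) :
  f ∘ assoc X Y Z ▷ U = g ∘ assoc X Y Z ▷ U -> f = g.
Proof. exact: cancel_epi (tail_inv U (assoc_invK X Y Z)). Qed.

Lemma assoc_mono X Y Z T (f g : T ~> (X ⊗ Y) ⊗ Z) :
  assoc X Y Z ∘ f = assoc X Y Z ∘ g -> f = g.
Proof. exact: cancel_mono (assocK X Y Z). Qed.

Lemma assoc_nat1 X X' Y Z (f : X ~> X') :
  assoc X' Y Z ∘ (f ▷ Y) ▷ Z = f ▷ (Y ⊗ Z) ∘ assoc X Y Z.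
Proof. by rewrite assoc_nat tensm_id. Qed.

Lemma assoc_nat2 X Y Y' Z (f : Y ~> Y') :
  assoc X Y' Z ∘ (X ◁ f) ▷ Z = X ◁ (f ▷ Z) ∘ assoc X Y Z.
Proof. by rewrite assoc_nat. Qed.

Lemma assoc_nat3 X Y Z Z' (f : Z ~> Z') :
  assoc X Y Z' ∘ (X ⊗ Y) ◁ f = X ◁ (Y ◁ f) ∘ assoc X Y Z.
Proof. by rewrite -tensm_id assoc_nat. Qed.

Lemma assoc_inv_nat3 X Y Z Z' (f : Z ~> Z') :
  assoc_inv X Y Z' ∘ X ◁ (Y ◁ f) = (X ⊗ Y) ◁ f ∘ assoc_inv X Y Z.
Proof.
apply: assoc_mono; apply: assoc_epi.
by rewrite !compA assoc_invK comp_idl assoc_nat3 -!compA !assocK !comp_idr.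
Qed.

Lemma lunit_inj X Y (f g : X ~> Y) : 𝟙 ◁ f = 𝟙 ◁ g -> f = g.
Proof.
move=> e; rewrite -[f]comp_idr -[g]comp_idr -(lunit_invK X) !compA.
by rewrite -!lunit_nat e.
Qed.

(** Kelly's lemma. As [𝟙 ◁ -] is faithful, the equation may be tested after
tensoring with [𝟙] on the left, where the pentagon reduces it to two triangles. *)
Lemma lunit_tens X Y : lunit (X ⊗ Y) ∘ assoc 𝟙 X Y = lunit X ▷ Y.
Proof.
apply: lunit_inj; rewrite whiskerD.
apply: assoc_epi; apply: assoc_tail_epi.
rewrite -assoc_nat2 -[RHS]compA -tailD triangle assoc_nat1.
by rewrite -triangle -!compA pentagon !compA.
Qed.

Lemma lunit_inv_nat X Y (f : X ~> Y) : 𝟙 ◁ f ∘ lunit_inv X = lunit_inv Y ∘ f.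
Proof.
rewrite -[LHS]comp_idl -(lunitK Y) -!compA; congr (_ ∘ _).
by rewrite compA lunit_nat -compA lunit_invK comp_idr.
Qed.

Lemma pentagon_inv X Y Z T :
  X ◁ assoc Y Z T ∘ assoc X (Y ⊗ Z) T
  = assoc X Y (Z ⊗ T) ∘ (assoc (X ⊗ Y) Z T ∘ assoc_inv X Y Z ▷ T).
Proof.
apply: assoc_tail_epi.
by rewrite -pentagon -!compA -tailD assocK tensm_id comp_idr.
Qed.

(** * Structure maps in front of a tail *)

(** These operations are locked because matching modulo unfolding would otherwise
see each of them as a composite and reassociate inside it. *)
Definition merge X Y X' (f : X ⊗ Y ~> X') Z : X ⊗ (Y ⊗ Z) ~> X' ⊗ Z :=
  locked (f ▷ Z ∘ assoc_inv X Y Z).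
Definition split X Y Y' (f : X ~> Y ⊗ Y') Z : X ⊗ Z ~> Y ⊗ (Y' ⊗ Z) :=
  locked (assoc Y Y' Z ∘ f ▷ Z).
Definition swap X Y Z : X ⊗ (Y ⊗ Z) ~> Y ⊗ (X ⊗ Z) :=
  locked (assoc Y X Z ∘ braid X Y ▷ Z ∘ assoc_inv X Y Z).
Definition create X (u : 𝟙 ~> X) Z : Z ~> X ⊗ Z :=
  locked (u ▷ Z ∘ lunit_inv Z).
Definition delete X (e : X ~> 𝟙) Z : X ⊗ Z ~> Z :=
  locked (lunit Z ∘ e ▷ Z).

Lemma mergeK X Y X' (f : X ⊗ Y ~> X') Z : merge f Z ∘ assoc X Y Z = f ▷ Z.
Proof. by rewrite /merge -lock -compA assocK comp_idr. Qed.

Lemma swapK X Y Z : swap X Y Z ∘ assoc X Y Z = assoc Y X Z ∘ braid X Y ▷ Z.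
Proof. by rewrite /swap -lock -compA assocK comp_idr. Qed.

Lemma mergeE X Y X' (f : X ⊗ Y ~> X') Z :
  merge f Z = f ▷ Z ∘ assoc_inv X Y Z.
Proof. by rewrite /merge -lock. Qed.

Lemma splitE X Y Y' (f : X ~> Y ⊗ Y') Z : split f Z = assoc Y Y' Z ∘ f ▷ Z.
Proof. by rewrite /split -lock. Qed.

Lemma merge_nat X Y X' (f : X ⊗ Y ~> X') Z Z' (h : Z ~> Z') :
  merge f Z' ∘ X ◁ (Y ◁ h) = X' ◁ h ∘ merge f Z.
Proof.
apply: assoc_epi.
by rewrite -!compA -assoc_nat3 mergeK compA mergeK exchange.
Qed.

Lemma split_nat X Y Y' (f : X ~> Y ⊗ Y') Z Z' (h : Z ~> Z') :
  split f Z' ∘ X ◁ h = Y ◁ (Y' ◁ h) ∘ split f Z.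
Proof. by rewrite !splitE -compA exchange !compA assoc_nat3. Qed.

Lemma swap_nat X Y Z Z' (h : Z ~> Z') :
  swap X Y Z' ∘ X ◁ (Y ◁ h) = Y ◁ (X ◁ h) ∘ swap X Y Z.
Proof.
apply: assoc_epi.
by rewrite -!compA -assoc_nat3 swapK !compA swapK -assoc_nat3 -!compA exchange.
Qed.

Lemma create_nat X (u : 𝟙 ~> X) Z Z' (h : Z ~> Z') :
  create u Z' ∘ h = X ◁ h ∘ create u Z.
Proof. by rewrite /create -!lock -compA -lunit_inv_nat !compA exchange. Qed.

Lemma delete_nat X (e : X ~> 𝟙) Z Z' (h : Z ~> Z') :
  delete e Z' ∘ X ◁ h = h ∘ delete e Z.
Proof. by rewrite /delete -!lock -compA exchange !compA lunit_nat. Qed.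

(** Enlarging the tail: these three lemmas express an operation with tail
[Q ⊗ U] through the same operation with tail [Q], tensored with [U]. *)
Lemma merge_assoc X Y P (f : X ⊗ Y ~> P) Q U :
  assoc P Q U ∘ merge f Q ▷ U
  = merge f (Q ⊗ U) ∘ (X ◁ assoc Y Q U ∘ assoc X (Y ⊗ Q) U).
Proof.
apply: assoc_tail_epi.
rewrite -!compA -tailD mergeK (compA (X ◁ _)) -pentagon assoc_nat1.
by rewrite !compA mergeK.
Qed.

Lemma split_assoc S X Y (p : S ~> X ⊗ Y) Q U :
  X ◁ assoc Y Q U ∘ (assoc X (Y ⊗ Q) U ∘ split p Q ▷ U)
  = split p (Q ⊗ U) ∘ assoc S Q U.
Proof. by rewrite !splitE tailD !compA -pentagon -compA assoc_nat1 !compA. Qed.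

Lemma swap_assoc X Y Q U :
  Y ◁ assoc X Q U ∘ (assoc Y (X ⊗ Q) U ∘ swap X Y Q ▷ U)
  = swap X Y (Q ⊗ U) ∘ (X ◁ assoc Y Q U ∘ assoc X (Y ⊗ Q) U).
Proof.
apply: assoc_tail_epi.
rewrite -!compA -tailD swapK -(splitE (braid X Y)) split_assoc.
by rewrite (compA (X ◁ _)) -pentagon splitE !compA swapK.
Qed.

(** * Sliding operations through crossings *)

Lemma swap_natl X X' Y Z (f : X ~> X') :
  swap X' Y Z ∘ f ▷ (Y ⊗ Z) = Y ◁ (f ▷ Z) ∘ swap X Y Z.
Proof.
apply: assoc_epi; rewrite -!compA -assoc_nat1 compA !swapK -compA -tailD.
by rewrite braid_nat tailD !compA assoc_nat2.
Qed.

Lemma swap_natr X Y Y' Z (f : Y ~> Y') :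
  swap X Y' Z ∘ X ◁ (f ▷ Z) = f ▷ (X ⊗ Z) ∘ swap X Y Z.
Proof.
apply: assoc_epi; rewrite -!compA -assoc_nat2 compA !swapK -compA -tailD.
by rewrite braid_nat tailD !compA assoc_nat1.
Qed.

(** The two hexagons in front of a tail: a strand crosses [X ⊗ Y] by crossing [X]
and [Y] one after the other. *)
Lemma swap_tensl X Y V Z :
  V ◁ assoc X Y Z ∘ swap (X ⊗ Y) V Z
  = swap X V (Y ⊗ Z) ∘ (X ◁ swap Y V Z ∘ assoc X Y (V ⊗ Z)).
Proof.
have hex : braid (X ⊗ Y) V = assoc V X Y ∘ (braid X V ▷ Y
    ∘ (assoc_inv X V Y ∘ (X ◁ braid Y V ∘ assoc X Y V))).
  rewrite (compA (assoc_inv _ _ _)) (compA (_ ▷ _)).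
  rewrite (compA (_ ▷ _) (assoc_inv _ _ _)) -hexagon2.
  by rewrite !compA assoc_invK comp_idl -compA assocK comp_idr.
apply: assoc_epi.
rewrite -!compA swapK hex !tailD (compA (V ◁ _)).
rewrite !(compA (V ◁ _ ∘ _)) -pentagon.
rewrite -!compA (compA (assoc (V ⊗ X) Y Z)) assoc_nat1.
rewrite !compA -swapK -!compA; congr (_ ∘ _).
rewrite (compA (assoc (X ⊗ V) Y Z)) (compA (assoc X V (Y ⊗ Z))).
rewrite -pentagon_inv -!compA (compA (assoc X (V ⊗ Y) Z)) assoc_nat2.
rewrite !compA -whiskerD -swapK whiskerD.
by rewrite -!compA pentagon !compA.
Qed.

Lemma swap_tensr X Y V Z :
  assoc X Y (V ⊗ Z) ∘ swap V (X ⊗ Y) Z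
  = X ◁ swap V Y Z ∘ (swap V X (Y ⊗ Z) ∘ V ◁ assoc X Y Z).
Proof.
have hex : braid V (X ⊗ Y) = assoc_inv X Y V ∘ (X ◁ braid V Y
    ∘ (assoc X V Y ∘ (braid V X ▷ Y ∘ assoc_inv V X Y))).
  rewrite (compA (assoc X V Y)) (compA (_ ◁ _)).
  rewrite (compA (_ ◁ _) (assoc _ _ _)) -hexagon1.
  by rewrite !compA assocK comp_idl -compA assoc_invK comp_idr.
apply: assoc_epi.
rewrite -!compA swapK pentagon_inv hex !tailD.
rewrite (compA (assoc (X ⊗ Y) V Z)) (compA (assoc X Y (V ⊗ Z))).
rewrite -pentagon_inv -!compA (compA (assoc X (Y ⊗ V) Z)) assoc_nat2.
rewrite !compA -whiskerD -swapK whiskerD -!compA; congr (_ ∘ _).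
rewrite (compA (assoc X (V ⊗ Y) Z)) (compA (X ◁ assoc V Y Z)).
rewrite (compA (X ◁ _)) -pentagon.
rewrite -!compA (compA (assoc (X ⊗ V) Y Z)) assoc_nat1.
by rewrite !compA swapK.
Qed.

(** By naturality of the braiding, a crossing with the output of [f] is a crossing
with its input; [swap_tensl] or [swap_tensr] then resolves that crossing. *)
Lemma swap_mergel X Y P V Z (f : X ⊗ Y ~> P) :
  swap P V Z ∘ merge f (V ⊗ Z)
  = V ◁ merge f Z ∘ (swap X V (Y ⊗ Z) ∘ X ◁ swap Y V Z).
Proof.
apply: assoc_epi; rewrite -!compA mergeK -swap_tensl swap_natl.
by rewrite compA -whiskerD mergeK.
Qed.

Lemma swap_merger X Y P V Z (f : X ⊗ Y ~> P) :
  swap V P Z ∘ V ◁ merge f Z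
  = merge f (V ⊗ Z) ∘ (X ◁ swap V Y Z ∘ swap V X (Y ⊗ Z)).
Proof.
apply: (cancel_epi (whisker_inv V (assoc_invK X Y Z))).
rewrite -!compA -whiskerD mergeK swap_natr -swap_tensr.
by rewrite compA mergeK.
Qed.

Lemma swap_splitl X Y P V Z (f : P ~> X ⊗ Y) :
  V ◁ split f Z ∘ swap P V Z
  = swap X V (Y ⊗ Z) ∘ (X ◁ swap Y V Z ∘ split f (V ⊗ Z)).
Proof.
by rewrite !splitE whiskerD -compA -swap_natl !compA swap_tensl !compA.
Qed.

Lemma swap_splitr X Y P V Z (f : P ~> X ⊗ Y) :
  split f (V ⊗ Z) ∘ swap V P Z
  = X ◁ swap V Y Z ∘ (swap V X (Y ⊗ Z) ∘ V ◁ split f Z).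
Proof.
by rewrite !splitE whiskerD -compA -swap_natr !compA swap_tensr !compA.
Qed.

Lemma swapP X Y Z : exists2 h, swap X Y Z ∘ h = idm _ & h ∘ swap X Y Z = idm _.
Proof.
exists (assoc X Y Z ∘ braid_inv X Y ▷ Z ∘ assoc_inv Y X Z).
  rewrite !compA swapK -(compA (assoc _ _ _)) -tailD braid_invK tensm_id.
  by rewrite comp_idr assoc_invK.
apply: assoc_epi; rewrite -!compA swapK (compA (assoc_inv _ _ _)) assocK.
by rewrite comp_idl -tailD braidK tensm_id comp_idl comp_idr.
Qed.

Lemma merge_lunit Z : merge (lunit 𝟙) Z = lunit (𝟙 ⊗ Z).
Proof. by apply: assoc_epi; rewrite mergeK lunit_tens. Qed.

(** The crossing with the unit object is trivial, although this is not among the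
axioms of a braiding. Sliding [lunit 𝟙 : 𝟙 ⊗ 𝟙 ~> 𝟙] through a crossing shows
that two crossings with [𝟙] amount to one; cancelling an invertible crossing
gives the claim for tails of the form [𝟙 ⊗ Z], and naturality along [lunit Z]
gives it for all tails. *)
Lemma swap_unitl V Z : V ◁ lunit Z ∘ swap 𝟙 V Z = lunit (V ⊗ Z).
Proof.
have [h hK _] := swapP 𝟙 V Z.
have step : lunit (V ⊗ (𝟙 ⊗ Z)) = V ◁ lunit (𝟙 ⊗ Z) ∘ swap 𝟙 V (𝟙 ⊗ Z).
  apply: (cancel_epi (whisker_inv 𝟙 hK)).
  by rewrite lunit_nat -!merge_lunit -compA -swap_mergel merge_lunit.
apply: (cancel_epi (whisker_inv 𝟙 (whisker_inv V (lunit_invK Z)))).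
rewrite lunit_nat -compA swap_nat step !compA -!whiskerD.
by rewrite -lunit_nat.
Qed.

Lemma swap_unitr V Z : lunit (V ⊗ Z) ∘ swap V 𝟙 Z = V ◁ lunit Z.
Proof.
have [h _ hK] := swapP V 𝟙 Z.
have step : lunit (V ⊗ (𝟙 ⊗ Z)) ∘ swap V 𝟙 (𝟙 ⊗ Z) = V ◁ lunit (𝟙 ⊗ Z).
  apply: (cancel_mono hK).
  by rewrite -merge_lunit swap_merger merge_lunit !compA lunit_nat.
apply: (cancel_epi (whisker_inv V (whisker_inv 𝟙 (lunit_invK Z)))).
by rewrite -compA swap_nat compA lunit_nat -compA step -!whiskerD lunit_nat.
Qed.

Lemma createE X (u : 𝟙 ~> X) Z : create u Z ∘ lunit Z = u ▷ Z.
Proof. by rewrite /create -lock -compA lunitK comp_idr. Qed.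

Lemma deleteE X (e : X ~> 𝟙) Z : delete e Z = lunit Z ∘ e ▷ Z.
Proof. by rewrite /delete -lock. Qed.

Lemma swap_create X V Z (u : 𝟙 ~> X) :
  swap X V Z ∘ create u (V ⊗ Z) = V ◁ create u Z.
Proof.
apply: (cancel_epi (lunit_invK _)).
rewrite -compA createE swap_natl -swap_unitl compA -whiskerD createE.
by [].
Qed.

Lemma swap_delete X V Z (e : X ~> 𝟙) :
  delete e (V ⊗ Z) ∘ swap V X Z = V ◁ delete e Z.
Proof. by rewrite !deleteE -compA -swap_natr compA swap_unitr whiskerD. Qed.

(** The braid relation: naturality of the crossing with [V] along [braid X Y]. *)
Lemma swap_braid X Y V Z :
  swap Y V (X ⊗ Z) ∘ (Y ◁ swap X V Z ∘ swap X Y (V ⊗ Z))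
  = V ◁ swap X Y Z ∘ (swap X V (Y ⊗ Z) ∘ X ◁ swap Y V Z).
Proof.
apply: assoc_epi; rewrite -!compA -swap_tensl swapK.
rewrite (compA (_ ◁ swap _ _ _)) (compA (swap _ _ _)) -swap_tensl.
rewrite -!compA swap_natl.
by rewrite !compA -!whiskerD swapK.
Qed.

(** * Axioms in front of a tail *)

Lemma mid_braidE P Q S S' X Y Z T (f : X ⊗ Z ~> P) (g : Y ⊗ T ~> Q)
    (p : S ~> X ⊗ Y) (q : S' ~> Z ⊗ T) :
  f ⊗₁ g ∘ mid_braid X Y Z T ∘ p ⊗₁ q
  = merge f Q ∘ (X ◁ (Z ◁ g) ∘ (X ◁ swap Y Z T ∘ (split p (Z ⊗ T) ∘ S ◁ q))).
Proof.
rewrite (tensmE f g) (tensmE p q) /mid_braid splitE /merge -lock.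
rewrite -!compA (compA (assoc_inv _ _ _) (X ◁ (Z ◁ g))) assoc_inv_nat3.
by rewrite /swap -lock -!compA.
Qed.

(** The composite of [mid_braidE] tensored with [U]: apply that lemma and enlarge
the tail of every factor. *)
Lemma mid_braid_tail P Q S S' X Y Z T U (f : X ⊗ Z ~> P) (g : Y ⊗ T ~> Q)
    (p : S ~> X ⊗ Y) (q : S' ~> Z ⊗ T) :
  assoc P Q U ∘ (f ⊗₁ g ∘ mid_braid X Y Z T ∘ p ⊗₁ q) ▷ U
  = merge f (Q ⊗ U) ∘ (X ◁ (Z ◁ merge g U) ∘ (X ◁ swap Y Z (T ⊗ U)
      ∘ (split p (Z ⊗ (T ⊗ U)) ∘ S ◁ split q U))) ∘ assoc S S' U.
Proof.
have inner : Z ◁ merge g U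
      ∘ (swap Y Z (T ⊗ U) ∘ (Y ◁ assoc Z T U ∘ assoc Y (Z ⊗ T) U))
    = assoc Z Q U ∘ (Z ◁ g ∘ swap Y Z T) ▷ U.
  rewrite -swap_assoc (compA (Z ◁ merge g U)) -whiskerD mergeK.
  by rewrite compA -assoc_nat2 tailD compA.
rewrite mid_braidE (splitE q) (whiskerD S) -!compA -assoc_nat2.
rewrite (compA _ (S ◁ assoc Z T U)) (split_nat p (assoc Z T U)) -!compA.
rewrite (compA (split p _) (assoc _ _ _)) -split_assoc -!compA -tailD.
rewrite (compA (X ◁ (Y ◁ assoc Z T U))) -whiskerD.
rewrite (compA (X ◁ swap Y Z (T ⊗ U))) -whiskerD.
rewrite (compA (X ◁ (Z ◁ merge g U))) -whiskerD inner whiskerD -!compA.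
rewrite (compA (X ◁ (_ ▷ _))) -assoc_nat2 -!compA.
rewrite (tailD _ (merge f Q)) compA merge_assoc -!compA -!tailD.
by rewrite whiskerD -!compA.
Qed.

Lemma merge_act (A V : C) (m : A ⊗ A ~> A) (a : A ⊗ V ~> V) Z :
  a ∘ m ▷ V = a ∘ A ◁ a ∘ assoc A A V ->
  merge a Z ∘ merge m (V ⊗ Z) = merge a Z ∘ A ◁ merge a Z.
Proof.
move=> e; apply: assoc_epi; apply: assoc_epi.
rewrite -!compA (compA (merge m _)) mergeK -assoc_nat1 compA mergeK -tailD e.
rewrite pentagon !compA -(compA (merge a Z)) -whiskerD mergeK.
by rewrite -(compA (merge a Z)) -assoc_nat2 compA mergeK -!tailD.
Qed.

Lemma act_create (A V : C) (u : 𝟙 ~> A) (a : A ⊗ V ~> V) Z :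
  a ∘ u ▷ V = lunit V -> merge a Z ∘ create u (V ⊗ Z) = idm (V ⊗ Z).
Proof.
move=> e; apply: (cancel_epi (lunit_invK _)); apply: assoc_epi.
rewrite -!compA (compA (create _ _)) createE -assoc_nat1 compA mergeK.
by rewrite -tailD e comp_idl lunit_tens.
Qed.

Lemma split_coact (B V : C) (D : B ~> B ⊗ B) (d : V ~> B ⊗ V) Z :
  assoc B B V ∘ D ▷ V ∘ d = B ◁ d ∘ d ->
  split D (V ⊗ Z) ∘ split d Z = B ◁ split d Z ∘ split d Z.
Proof.
move=> e; rewrite (splitE d) compA -split_assoc -!compA -tailD splitE e.
by rewrite tailD (compA (assoc B _ _)) assoc_nat2 !compA whiskerD.
Qed.

Lemma delete_coact (B V : C) (e : B ~> 𝟙) (d : V ~> B ⊗ V) Z :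
  lunit V ∘ e ▷ V ∘ d = idm V -> delete e (V ⊗ Z) ∘ split d Z = idm (V ⊗ Z).
Proof.
move=> ed; rewrite deleteE splitE -!compA (compA (e ▷ _)) -assoc_nat1.
by rewrite !compA lunit_tens -!tailD ed tensm_id.
Qed.

(** One statement for the multiplicativity of [Δ] and of the coaction of a
comodule algebra. *)
Lemma split_merge P P' Q S S' X Y Z T U (n : S ⊗ S' ~> P') (c : P' ~> P ⊗ Q)
    (f : X ⊗ Z ~> P) (g : Y ⊗ T ~> Q) (p : S ~> X ⊗ Y) (q : S' ~> Z ⊗ T) :
  c ∘ n = f ⊗₁ g ∘ mid_braid X Y Z T ∘ p ⊗₁ q ->
  split c U ∘ merge n U
  = merge f (Q ⊗ U) ∘ (X ◁ (Z ◁ merge g U) ∘ (X ◁ swap Y Z (T ⊗ U)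
      ∘ (split p (Z ⊗ (T ⊗ U)) ∘ S ◁ split q U))).
Proof.
move=> e; apply: assoc_epi.
by rewrite -mid_braid_tail -e tailD splitE -!compA mergeK.
Qed.

Lemma split_create P Q R Z (u : 𝟙 ~> R) (c : R ~> P ⊗ Q) (v : 𝟙 ~> P)
    (w : 𝟙 ~> Q) :
  c ∘ u = v ⊗₁ w ∘ lunit_inv 𝟙 ->
  split c Z ∘ create u Z = create v (Q ⊗ Z) ∘ create w Z.
Proof.
move=> e; have linv : assoc 𝟙 𝟙 Z ∘ lunit_inv 𝟙 ▷ Z = lunit_inv (𝟙 ⊗ Z).
  apply: (cancel_mono (lunitK _)).
  by rewrite compA lunit_tens -tailD !lunit_invK tensm_id.
rewrite splitE /create -!lock -!compA (compA (c ▷ Z)) -tailD e tailD -compA.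
rewrite (compA (assoc _ _ _)) assoc_nat -compA (compA (assoc _ _ _)) linv.
by rewrite tensmE -!compA (compA (𝟙 ◁ _)) lunit_inv_nat !compA.
Qed.

Lemma delete_merge B Z (m : B ⊗ B ~> B) (e : B ~> 𝟙) :
  e ∘ m = lunit 𝟙 ∘ e ⊗₁ e ->
  delete e Z ∘ merge m Z = delete e Z ∘ delete e (B ⊗ Z).
Proof.
move=> em; apply: assoc_epi.
rewrite !deleteE -!compA mergeK -tailD em tailD -lunit_tens -!compA.
rewrite assoc_nat (compA (e ▷ Z)) -lunit_nat -!compA (compA (𝟙 ◁ _)).
by rewrite -tensm_comp comp_idl comp_idr.
Qed.

Lemma assoc_braid X Y Z U S (t : S ~> (Z ⊗ (X ⊗ Y)) ⊗ U) :
  Z ◁ assoc Y X U ∘ (assoc Z (Y ⊗ X) U ∘ ((Z ◁ braid X Y) ▷ U ∘ t))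
  = Z ◁ swap X Y U ∘ (Z ◁ assoc X Y U ∘ (assoc Z (X ⊗ Y) U ∘ t)).
Proof.
rewrite (compA (assoc _ _ _)) assoc_nat2 !compA -!whiskerD.
by rewrite swapK.
Qed.

(** The left-hand side is covered by [mid_braid_tail]. On the right-hand side the
second strand [B] passes to the right of [V] and back, and the tail is enlarged
one factor at a time. *)
Lemma yd_tail (B : bialgebra C) (V : yd_module B) U :
  merge (bi_mul B) (V ⊗ U) ∘ (B ◁ (B ◁ merge (yd_act V) U)
    ∘ (B ◁ swap B B (V ⊗ U) ∘ (split (bi_comul B) (B ⊗ (V ⊗ U))
    ∘ B ◁ split (yd_coact V) U)))
  = merge (bi_mul B) (V ⊗ U) ∘ (B ◁ swap V B U
    ∘ (split (yd_coact V) (B ⊗ U) ∘ (merge (yd_act V) (B ⊗ U)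
    ∘ (B ◁ swap B V U ∘ split (bi_comul B) (V ⊗ U))))).
Proof.
apply: assoc_epi; rewrite -mid_braid_tail yd_compat.
rewrite -(mergeE (bi_mul B)) (tailD _ (yd_coact V)) -!compA.
rewrite (compA (assoc B V B)) -(splitE (yd_coact V)).
rewrite (compA (yd_act V ▷ B)) -mergeE -(splitE (bi_comul B)) !tailD.
rewrite compA merge_assoc -!compA.
rewrite assoc_braid (compA (assoc B (V ⊗ B) U)) (compA (B ◁ assoc V B U)).
rewrite split_assoc -!compA.
rewrite (compA (assoc _ _ _) (merge _ _ ▷ U)) merge_assoc -!compA.
by rewrite assoc_braid split_assoc.
Qed.

End Whiskering.

(** * The tensor product of a Yetter-Drinfeld module and a relative module *)

Ltac normalize := rewrite ?whiskerD -?compA.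

(* [slide E] rewrites with [E], an equation whose left-hand side is a right-nested
   composite of two or three factors, inside a right-nested composite, under at
   most three tensored identities. *)
Tactic Notation "slide" uconstr(E) :=
  first
  [ rewrite (at_head2 _ E) | rewrite (at_head3 _ E)
  | rewrite (at_head2 _ (whisker2 _ E)) | rewrite (at_head3 _ (whisker3 _ E))
  | rewrite (at_head2 _ (whisker2 _ (whisker2 _ E)))
  | rewrite (at_head3 _ (whisker3 _ (whisker3 _ E)))
  | rewrite (at_head2 _ (whisker2 _ (whisker2 _ (whisker2 _ E))))
  | rewrite (at_head3 _ (whisker3 _ (whisker3 _ (whisker3 _ E)))) ];
  normalize.

Section Triangle.
Context (k : fieldType) (C : braided_category k) (B : bialgebra C)
    (A : comodule_algebra B) (V : yd_module B) (W : mod_comod A).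

Local Notation m := (bi_mul B).
Local Notation D := (bi_comul B).
Local Notation aV := (yd_act V).
Local Notation dV := (yd_coact V).
Local Notation aW := (mc_act W).
Local Notation dW := (mc_coact W).
Local Notation dA := (ca_coact A).
Local Notation mA := (ca_mul A).

Lemma tri_actE : tri_act V W =
  merge aV W ∘ (B ◁ (V ◁ aW) ∘ (B ◁ swap A V W ∘ split dA (V ⊗ W))).
Proof. by rewrite /tri_act mid_braidE tensm_id comp_idr. Qed.

Lemma tri_coactE : tri_coact V W =
  merge m (V ⊗ W) ∘ (B ◁ swap V B W ∘ (split dV (B ⊗ W) ∘ V ◁ dW)).
Proof. by rewrite /tri_coact mid_braidE !tensm_id comp_idl. Qed.

(** The unit of [A] coacts to the units of [B] and [A]; the latter passes behind
[V], and each acts as the identity. *)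
Lemma tri_unit : tri_act V W ∘ create (ca_one A) (V ⊗ W) = idm (V ⊗ W).
Proof.
have [[_ unitW] _ _] := mc_axioms W.
have uW : aW ∘ create (ca_one A) W = idm W.
  apply: (cancel_epi (lunit_invK W)).
  by rewrite -compA createE unitW comp_idl.
have uV := act_create W (mod_unit (yd_is_module V)).
rewrite tri_actE -!compA (split_create _ (ca_coact_one A)).
rewrite (compA (B ◁ swap _ _ _)) -create_nat -!compA.
rewrite swap_create (compA (B ◁ _)) -create_nat -!compA -whiskerD uW.
by rewrite tensm_id comp_idr uV.
Qed.

(** Dual to [tri_unit]: [ε] of a product is the product of the counits. *)
Lemma tri_counit : delete (bi_counit B) (V ⊗ W) ∘ tri_coact V W = idm (V ⊗ W).
Proof.
have [_ [_ cW] _] := mc_axioms W.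
have uW : delete (bi_counit B) W ∘ dW = idm W by rewrite deleteE.
have uV := delete_coact (B ⊗ W) (comod_counit (yd_is_comodule V)).
rewrite tri_coactE compA (delete_merge _ (bi_counit_mul B)) -!compA.
rewrite (compA (delete _ (B ⊗ _))) delete_nat -!compA.
rewrite (compA (delete _ (V ⊗ (B ⊗ W)))) uV comp_idl.
by rewrite compA swap_delete -whiskerD uW tensm_id.
Qed.

(** Multiplicativity of [δ_A] distributes the product over both factors, where the
module axioms apply. *)
Lemma tri_assoc :
  tri_act V W ∘ merge mA (V ⊗ W) = tri_act V W ∘ A ◁ tri_act V W.
Proof.
have [[assocW _] _ _] := mc_axioms W.
have aaW : aW ∘ merge mA W = aW ∘ A ◁ aW.
  by apply: assoc_epi; rewrite -compA mergeK.
have aaV Z := merge_act Z (mod_assoc (yd_is_module V)).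
have dmA Z := split_merge Z (ca_coact_mul A).
rewrite -[LHS]comp_idr -[RHS]comp_idr tri_actE; normalize.
(* Left side: split the product of [A] along [δ_A] and distribute it over the
   actions on [V] and [W]. *)
slide (dmA (V ⊗ W)).
slide (esym (merge_nat m (swap A V W))).
slide (esym (merge_nat m (V ◁ aW))).
slide (aaV W).
slide (swap_mergel V W mA).
slide aaW.
(* Right side: pull the two actions on [V] together to the left. *)
slide (split_nat dA (merge aV W)).
slide (swap_merger A W aV).
slide (esym (merge_nat aV aW)).
slide (split_nat dA (B ◁ (V ◁ aW))).
slide (swap_nat A B (V ◁ aW)).
slide (swap_nat A V aW).
slide (split_nat dA (B ◁ swap A V W)).
slide (swap_nat A B (swap A V W)).
by [].
Qed.

(** Multiplicativity of [Δ] replaces [Δ] of the product by the product of the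
comultiplications of the two coactions, where the comodule axioms apply. *)
Lemma tri_coassoc :
  split D (V ⊗ W) ∘ tri_coact V W = B ◁ tri_coact V W ∘ tri_coact V W.
Proof.
have [_ [coassocW _] _] := mc_axioms W.
have ddW : split D W ∘ dW = B ◁ dW ∘ dW by rewrite splitE.
have ddV Z := split_coact Z (comod_coassoc (yd_is_comodule V)).
have Dm Z := split_merge Z (bi_comul_mul B).
rewrite -[LHS]comp_idr -[RHS]comp_idr tri_coactE; normalize.
(* Left side: carry [Δ] through the product and the crossing down to [W], where
   it turns into a second coaction. *)
slide (Dm (V ⊗ W)).
slide (swap_splitr V W D).
slide (esym (split_nat dV (split D W))).
slide ddW.
slide (split_nat D (B ◁ swap V B W)).
(* Right side: carry the second coaction past the first, so that the two
   coactions of [V] meet and become [Δ]. *)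
slide (esym (merge_nat m (V ◁ dW))).
slide (esym (swap_nat V B dW)).
slide (esym (split_nat dV (B ◁ dW))).
slide (esym (merge_nat m (split dV (B ⊗ W)))).
slide (swap_splitl B (B ⊗ W) dV).
slide (esym (ddV (B ⊗ (B ⊗ W)))).
slide (esym (merge_nat m (B ◁ swap V B W))).
slide (esym (merge_nat m (merge m (V ⊗ W)))).
(* Move the remaining crossings of the left side past [Δ]. *)
slide (split_nat D (swap V B (B ⊗ W))).
slide (swap_nat B B (swap V B W)).
by [].
Qed.

(** Both sides are brought to a common form in which coactions, [Δ] and crossings
come first, then actions, then products. The compatibility of [W] and the
coassociativity of [A] expose the right-hand side of the Yetter-Drinfeld
condition in [δ a], while the other composite yields the arrangement of its
left-hand side. *)
Lemma tri_compat :
  tri_coact V W ∘ tri_act V W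
  = (bi_mul B ⊗₁ tri_act V W) ∘ mid_braid B A B (V ⊗ W)
    ∘ (ca_coact A ⊗₁ tri_coact V W).
Proof.
have [_ _ compatW] := mc_axioms W.
have daW : dW ∘ aW = merge m W ∘ (B ◁ (B ◁ aW) ∘ (B ◁ swap A B W
    ∘ (split dA (B ⊗ W) ∘ A ◁ dW))) by rewrite compatW mid_braidE.
have ddA Z := split_coact Z (comod_coassoc (ca_is_comodule A)).
have mm Z := merge_act Z (alg_assoc (bi_is_algebra B)).
rewrite mid_braidE -[LHS]comp_idr -[RHS]comp_idr tri_actE tri_coactE; normalize.
(* Left side: expand [δ_W a_W] and carry the product it creates to the far left,
   past [V]. *)
slide (esym (merge_nat aV dW)).
slide daW.
slide (merge_nat aV (merge m W)).
slide (split_nat dV (merge m W)).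
slide (swap_merger V W m).
slide (esym (mm (V ⊗ W))).
slide (merge_nat m (swap V B W)).
(* Clear the strands next to [V] of the operations on [W]. *)
slide (merge_nat aV (B ◁ (B ◁ aW))).
slide (split_nat dV (B ◁ (B ◁ aW))).
slide (swap_nat V B (B ◁ aW)).
slide (merge_nat m (V ◁ (B ◁ aW))).
slide (merge_nat aV (B ◁ swap A B W)).
slide (split_nat dV (B ◁ swap A B W)).
slide (swap_nat V B (swap A B W)).
slide (merge_nat m (V ◁ swap A B W)).
slide (esym (swap_nat A V dW)).
slide (esym (split_nat dA (V ◁ dW))).
(* The two copies of [δ_A] meet and become [Δ] after [δ_A]. *)
slide (swap_splitl V (B ⊗ W) dA).
slide (esym (ddA (V ⊗ (B ⊗ W)))).
slide (esym (split_nat D (swap A V (B ⊗ W)))).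
(* The six factors from the inner product to [Δ] are the right-hand side of the
   Yetter-Drinfeld condition. *)
rewrite (at_head6 _ (esym (yd_tail V (A ⊗ (B ⊗ W))))); normalize.
(* Carry products and actions to the left of all crossings, and [δ_V] to the
   right of them. *)
slide (esym (merge_nat m (V ◁ swap A B W))).
slide (esym (merge_nat m (V ◁ (B ◁ aW)))).
slide (esym (merge_nat m (swap V B W))).
slide (esym (merge_nat aV (swap A B W))).
slide (esym (merge_nat aV (B ◁ aW))).
slide (swap_mergel B W aV).
slide (swap_splitr A (B ⊗ W) dV).
slide (esym (split_nat dA (split dV (B ⊗ W)))).
slide (split_nat D (B ◁ swap A V (B ⊗ W))).
slide (swap_nat B B (swap A V (B ⊗ W))).
slide (swap_nat V B aW).
slide (swap_braid A V B W).
slide (swap_nat B B (V ◁ aW)).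
slide (swap_nat B B (swap A V W)).
(* Right side: the two copies of [δ_A] again become [Δ] after [δ_A]. *)
slide (swap_splitl B (V ⊗ W) dA).
slide (esym (ddA (B ⊗ (V ⊗ W)))).
(* The product inside the coaction travels to the far left. *)
slide (split_nat dA (merge m (V ⊗ W))).
slide (split_nat D (A ◁ merge m (V ⊗ W))).
slide (swap_merger A (V ⊗ W) m).
slide (swap_merger B (A ⊗ (V ⊗ W)) m).
slide (esym (merge_nat m (B ◁ swap A V W))).
slide (esym (merge_nat m (B ◁ (V ◁ aW)))).
slide (esym (merge_nat m (merge aV W))).
slide (esym (mm (V ⊗ W))).
(* Only crossings remain to be put in the same order on both sides. *)
slide (split_nat dA (B ◁ swap V B W)).
slide (split_nat D (A ◁ (B ◁ swap V B W))).
slide (swap_nat A B (swap V B W)).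
slide (esym (split_nat D (swap A B (V ⊗ (B ⊗ W))))).
slide (swap_nat B B (swap A B (V ⊗ W))).
slide (swap_nat B B (A ◁ swap V B W)).
by [].
Qed.

End Triangle.

Theorem theorem2p3 (k : fieldType) (C : braided_category k) (B : bialgebra C)
    (A : comodule_algebra B) (V : yd_module B) (W : mod_comod A) :
  is_mod_comod (tri_act V W) (tri_coact V W).
Proof.
split.
- split.
    by rewrite -(mergeK (ca_mul A)) compA tri_assoc.
  by rewrite -createE compA tri_unit comp_idl.
- split; first by rewrite -splitE tri_coassoc.
  by rewrite -deleteE tri_counit.
- exact: tri_compat.
Qed.
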